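(* Let $\varepsilon>0$ be fixed. For any integer $S$ and large positive integer $m$, the set $$\{xy\pmod m:\ 1\le x\le m^{1/2},\ S+1\le y\le S+m^{1/2}(\log m)^{2+\varepsilon}\}$$ (with $x,y$ integers) contains $(1+O((\log m)^{-\varepsilon}))\,m$ residue classes modulo $m$.
   Context: The asymptotic statement is for $m\to\infty$; the constant implied by $O$ may depend on $\varepsilon$ but is uniform in $m$ and $S$. *)

(* Defs.v *)
From HB Require Import structures.
From mathcomp Require Import all_boot all_order all_algebra.
From mathcomp Require Import all_classical all_reals all_analysis.

Set Implicit Arguments.
Unset Strict Implicit.
Unset Printing Implicit Defensive.

Import Order.TTheory GRing.Theory Num.Theory.
Local Open Scope ring_scope.

(* Residue classes modulo m are represented by their least nonnegative
   representatives r : 'I_m.  The bounds on x and y are real inequalities;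
   no integer part of m^(1/2) or of the length of the y-range is taken. *)
Definition product_residues (R : realType) (eps : R) (m : nat) (S : int) :
    {set 'I_m} :=
  [set r : 'I_m | `[< exists x y : int,
     [/\ 1 <= x,
         x%:~R <= m%:R `^ (2^-1) :> R,
         S + 1 <= y,
         y%:~R <= S%:~R + m%:R `^ (2^-1) * ln m%:R `^ (2 + eps) :> R
       & (x * y = (r : nat)%:Z %[mod m%:Z])%Z] >] ].

(* Main.v *)
Require Import Defs.
From HB Require Import structures.
From mathcomp Require Import all_boot all_order all_algebra.
From mathcomp Require Import all_classical all_reals all_analysis.
From mathcomp Require Import fintype finset zify ring lra.

Set Implicit Arguments.
Unset Strict Implicit.
Unset Printing Implicit Defensive.

Import Order.TTheory GRing.Theory Num.Theory.
Local Open Scope ring_scope.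

(* Let X consist of primes x <= m^(1/2) not dividing m, let I be the interval of
   the y's, of length N, and count the solutions of x1 y1 = x2 y2 (mod m).
   For x1 = x2 there are N of them.  For coprime x1, x2 there are at most
   N^2/m + N/x2 + (x1 + x2)N/m + 1, by splitting according to the value of
   (x1 y1 - x2 y2)/m.  By Cauchy-Schwarz, (|X| N)^2 is at most the number of
   residues hit times the number of solutions, so that few residues are missed
   as soon as |X| and min X are both at least of order m^(1/2) / log m; this
   follows from 2^n <= 'C(2n, n) <= (2n)^pi(2n). *)

(** * Cauchy-Schwarz for fibres, and counting in a residue class *)

Lemma sum_sqr_le (I : finType) (A : {set I}) (a : I -> nat) :
  ((\sum_(i in A) a i) ^ 2 <= #|A| * \sum_(i in A) a i ^ 2)%N.
Proof.
rewrite -(leq_pmul2l (isT : 0 < 2)%N).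
have -> : (2 * (#|A| * \sum_(i in A) a i ^ 2) =
  \sum_(i in A) \sum_(j in A) (a i ^ 2 + a j ^ 2))%N.
  under [RHS]eq_bigr do rewrite big_split /= sum_nat_const.
  by rewrite big_split /= sum_nat_const -big_distrr /= mul2n addnn.
rewrite -mulnn big_distrlr /= big_distrr /=; apply: leq_sum => i _.
by rewrite big_distrr /=; apply: leq_sum => j _; apply: nat_Cauchy.
Qed.

(** Cauchy-Schwarz applied to the fibre sizes [c u]: they add up to the size of [D], and their
    squares add up to the number of pairs with equal image. *)
Lemma card_sqr_le_imset (T U : finType) (D : {set T}) (f : T -> U) :
  (#|D| ^ 2 <= #|f @: D| * #|[set p in setX D D | f p.1 == f p.2]|)%N.
Proof.
pose c u := #|[set t in D | f t == u]|.
have -> : #|D| = (\sum_(u in f @: D) c u)%N.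
  rewrite -sum1_card (partition_big_imset f) /=; apply: eq_bigr => u _.
  by rewrite /c -sum1_card; apply: eq_bigl => t; rewrite inE.
apply: leq_trans (sum_sqr_le _ _) _; rewrite leq_mul2l; apply/orP; right.
rewrite -[leqRHS]sum1_card (partition_big (fun p => f p.1) [in f @: D]) /=; last first.
  by move=> p; rewrite !inE => /andP[/andP[Dp _] _]; apply: imset_f.
apply: leq_sum => u _; rewrite sum1_card -mulnn /c -cardsX.
apply: subset_leq_card; apply/subsetP => -[s t]; rewrite !inE /=.
move=> /andP[/andP[Ds /eqP fs] /andP[Dt /eqP ft]].
by rewrite unfold_in /= !inE /= Ds Dt fs ft eqxx.
Qed.

(** The differences [g b - v] share one remainder modulo [q], so the quotient by [q], at most
    [w %/ q], determines [b]. *)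
Lemma card_congruent_le (T : finType) (B : {set T}) (g : T -> nat) (q v w : nat) :
  (0 < q)%N -> {in B &, injective g} ->
  {in B &, forall b b', g b = g b' %[mod q]} ->
  {in B, forall b, v <= g b <= v + w}%N -> (#|B| <= (w %/ q).+1)%N.
Proof.
move=> q0 ginj gmod gB.
pose h b : 'I_(w %/ q).+1 := inord ((g b - v) %/ q).
rewrite -[X in (_ <= X)%N](card_ord) -(card_in_imset (f := h)); first exact: max_card.
move=> b b' Bb Bb' /(congr1 val); have /andP[vb bw] := gB _ Bb.
have /andP[vb' bw'] := gB _ Bb'.
rewrite /= !inordK ?ltnS; try by apply: leq_div2r; lia.
move=> e; apply: ginj => //.
have /eqP := gmod _ _ Bb Bb'; rewrite -(subnK vb) -(subnK vb') eqn_modDr => /eqP e'.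
by rewrite (divn_eq (g b - v) q) (divn_eq (g b' - v) q) e e'.
Qed.

(** * Linear congruences in a box *)

Lemma eqn_mod_coprimel (d a b c : nat) :
  coprime a d -> (a * b == a * c %[mod d])%N -> b = c %[mod d].
Proof.
move=> co; wlog cb : b c / (c <= b)%N => [th|].
  case/orP: (leq_total c b) => h; first exact: th.
  by rewrite eq_sym => /(th _ _ h) ->.
rewrite eqn_mod_dvd ?leq_mul2l ?cb ?orbT // -mulnBr Gauss_dvdr 1?coprime_sym //.
by rewrite -eqn_mod_dvd // => /eqP.
Qed.

(* Writing [x1 * i + x2 * j = m * k + e], for fixed [k] the admissible [i] lie
   in one class modulo [x2] and in an interval, so that they number at most
   [1 + length / x2]; for fixed [i] the admissible [k] form a short interval. *)
Lemma card_lin_congruence_le (N m e x1 x2 : nat) :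
  (0 < m)%N -> (0 < x2)%N -> coprime x1 x2 -> (e < m)%N ->
  (m * x2 * #|[set p : 'I_N * 'I_N | x1 * p.1 + x2 * p.2 == e %[mod m]]| <=
   N * N * x2 + N * m + x2 * ((x1 + x2) * N + m))%N.
Proof.
move=> m0 x20 co em.
case: N => [|N]; first by rewrite eq_card0 ?muln0 // => -[[]].
set Z := [set p | _].
set K := (((x1 + x2) * N) %/ m).+1.
(* [A k] keeps only the size constraint on [i]: the value required of [x2 * j] lies between [0] and
   [x2 * N]. Divisibility by [x2] is ignored. *)
pose A (k : nat) := [set i : 'I_N.+1 | x1 * i <= m * k + e <= x1 * i + x2 * N]%N.
pose Zk (k : nat) := [set p : 'I_N.+1 * 'I_N.+1 | x1 * p.1 + x2 * p.2 == m * k + e]%N.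
have ZE : (#|Z| <= \sum_(k < K) #|Zk k|)%N.
  have sub : Z \subset \bigcup_(k < K) Zk k.
    apply/subsetP => -[i j]; rewrite inE /= => /eqP.
    rewrite (modn_small em) => mE.
    have E := divn_eq (x1 * i + x2 * j) m; rewrite mE in E.
    have kK : ((x1 * i + x2 * j) %/ m < K)%N.
      rewrite ltnS leq_div2r // mulnDl leq_add // leq_mul2l -ltnS ltn_ord orbT //.
    by apply/bigcupP; exists (Ordinal kK) => //; rewrite inE /= [(m * _)%N]mulnC -E.
  apply: leq_trans (subset_leq_card sub) _.
  apply: (big_ind2 (fun (a : {set _}) b => #|a| <= b)%N) => //; first by rewrite cards0.
  by move=> a b c d ab cd; apply: leq_trans (leq_card_setU _ _) (leq_add ab cd).
(* A solution is determined by its [i], and these [i] agree modulo [x2]. Since [A k] is convex, it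
   contains the whole interval between the least and the greatest of them. *)
have ZkA (k : nat) : (#|Zk k| * x2 <= #|A k| + x2)%N.
  pose B := fst @: Zk k.
  have cB : #|B| = #|Zk k|.
    apply: card_in_imset => -[i j] [i' j']; rewrite !inE /= => /eqP E /eqP E' ii.
    move: E; rewrite -E' ii => /addnI /eqP; rewrite eqn_pmul2l // => /eqP jj.
    by congr pair; apply: val_inj.
  have BP b : b \in B -> exists2 j : 'I_N.+1, b \in A k & (x1 * b + x2 * j = m * k + e)%N.
    case/imsetP => -[i j]; rewrite inE /= => /eqP E ->; exists j => //.
    rewrite inE; apply/andP; have := ltn_ord j; rewrite ltnS => jN; split.
      by rewrite -E leq_addr.
    by rewrite -E leq_add2l leq_mul2l jN orbT.
  rewrite -cB; have [->|[b0 Bb0]] := set_0Vmem B; first by rewrite cards0.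
  case: (@arg_minnP _ b0 [in B] val Bb0) => lo Blo loP.
  case: (@arg_maxnP _ b0 [in B] val Bb0) => hi Bhi hiP.
  have lohi : (lo <= hi)%N by exact: loP.
  have cAk : ((hi - lo).+1 <= #|A k|)%N.
    pose f (s : 'I_(hi - lo).+1) : 'I_N.+1 := inord (lo + s).
    rewrite -[X in (X <= _)%N]card_ord -(card_imset (f := f)); last first.
      rewrite /f => s s' /(congr1 val) /=; have := ltn_ord s; have := ltn_ord s'.
      have := ltn_ord hi => h1 h2 h3.
      rewrite !inordK; try lia.
      by move=> /addnI /val_inj.
    apply: subset_leq_card; apply/subsetP => _ /imsetP[s _ ->].
    rewrite inE /f; have h3 := ltn_ord s; have h2 := ltn_ord hi.
    rewrite !inordK; try lia.
    have [_ + _] := BP _ Blo; have [_ + _] := BP _ Bhi; rewrite !inE.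
    move=> /andP[h _] /andP[_ l].
    apply/andP; split.
      by apply: leq_trans h; rewrite leq_mul2l; apply/orP; right; lia.
    by apply: leq_trans l _; rewrite leq_add2r leq_mul2l leq_addr orbT.
  have Bw : (#|B| <= ((hi - lo) %/ x2).+1)%N.
    apply: (@card_congruent_le _ _ val _ lo) => //; first by move=> ? ? _ _; apply: val_inj.
      move=> b b' /BP[j _ E] /BP[j' _ E'].
      have : (x1 * b + x2 * j = x1 * b' + x2 * j' %[mod x2])%N by rewrite E E'.
      rewrite !(addnC (x1 * _)) ![(x2 * _)%N]mulnC !modnMDl => /eqP.
      exact: eqn_mod_coprimel.
    by move=> b Bb; rewrite subnKC //; apply/andP; split; [exact: loP|exact: hiP].
  apply: (@leq_trans (((hi - lo) %/ x2).+1 * x2)); first by rewrite leq_mul2r Bw orbT.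
  rewrite mulSn addnC leq_add2r; apply: leq_trans (leq_trunc_div _ _) _.
  exact: leq_trans cAk.
(* Exchange the sums: for fixed [i], the numbers [m * k + e] lie in one class modulo [m] and in an
   interval of length [x2 * N]. *)
have AE : (\sum_(k < K) #|A k| <= N.+1 * ((x2 * N) %/ m).+1)%N.
  under eq_bigr do rewrite -sum1dep_card big_mkcond.
  rewrite exchange_big /= -[X in (_ <= X * _)%N]card_ord -sum_nat_const.
  apply: leq_sum => i _; rewrite -big_mkcond sum1dep_card.
  apply: (@card_congruent_le _ _ (fun k : 'I_K => (m * k + e)%N) _ (x1 * i)) => //.
  - move=> k k' _ _ /addIn /eqP; rewrite eqn_pmul2l // => /eqP; exact: val_inj.
  - by move=> k k' _ _; rewrite ![(m * _)%N]mulnC !modnMDl.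
  - by move=> k; rewrite inE.
have : (#|Z| * x2 <= N.+1 * ((x2 * N) %/ m).+1 + K * x2)%N.
  apply: leq_trans (_ : \sum_(k < K) (#|A k| + x2) <= _)%N.
    apply: leq_trans (_ : \sum_(k < K) #|Zk k| * x2 <= _)%N.
      by rewrite -big_distrl leq_mul2r ZE orbT.
    exact: leq_sum.
  by rewrite big_split /= sum_nat_const card_ord leq_add2r.
rewrite -(leq_pmul2l m0) => h; apply: leq_trans (_ : m * (#|Z| * x2) <= _)%N.
  by rewrite -mulnA [(x2 * _)%N]mulnC.
apply: leq_trans h _.
have h1 := leq_trunc_div (x2 * N) m; have h2 := leq_trunc_div ((x1 + x2) * N) m.
rewrite /K; nia.
Qed.

(** * Chebyshev's lower bound for the number of primes *)

(** By Legendre's formula the exponent is the sum over [k] of [n.*2 %/ p ^ k] minus twice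
    [n %/ p ^ k]. Each term is 0 or 1, and it vanishes once [p ^ k] exceeds [n.*2]. *)
Lemma logn_central_binomial_le (n p : nat) : (0 < n)%N -> prime p ->
  (logn p 'C(n.*2, n) <= trunc_log p n.*2)%N.
Proof.
move=> n0 pp.
have p1 := prime_gt1 pp.
have le : (n <= n.*2)%N by rewrite -addnn leq_addr.
have binE : (logn p 'C(n.*2, n) + (logn p n`! + logn p n`!) = logn p n.*2`!)%N.
  rewrite -(bin_fact le) !lognM ?muln_gt0 ?fact_gt0 ?bin_gt0 //.
  by rewrite -addnn addnK.
(* Zero terms are appended so that both Legendre sums have the same range. *)
have lognE' : logn p n`! = (\sum_(1 <= k < n.*2.+1) n %/ p ^ k)%N.
  rewrite logn_fact // (@big_cat_nat _ _ _ n.+1 1 n.*2.+1) //=.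
  rewrite [X in (_ = _ + X)%N]big1_seq ?addn0 // => k /andP[_].
  rewrite mem_index_iota => /andP[nk _].
  by rewrite divn_small // (leq_trans nk) // ltnW // ltn_expl.
set t := trunc_log p n.*2.
have t_le : (t <= n.*2)%N.
  by apply: leq_trans (ltnW (ltn_expl t p1)) _; apply: trunc_logP => //; rewrite double_gt0.
rewrite -(leq_add2r (logn p n`! + logn p n`!)) binE logn_fact // lognE' -big_split /=.
rewrite (@big_cat_nat _ _ _ t.+1 1 n.*2.+1) //=.
rewrite [X in (_ + X <= _)%N]big1_seq ?addn0 => [|k /andP[_]]; last first.
  rewrite mem_index_iota => /andP[tk _]; rewrite divn_small //.
  apply: leq_trans (trunc_log_ltn _ p1) _.
  by rewrite leq_exp2l.
apply: (@leq_trans (\sum_(1 <= k < t.+1) (1 + (n %/ p ^ k + n %/ p ^ k)))).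
  apply: leq_sum => k _; have pk : (0 < p ^ k)%N by rewrite expn_gt0 prime_gt0.
  have E := divn_eq n (p ^ k); have h := ltn_pmod n pk.
  rewrite -ltnS ltn_divLR //; nia.
rewrite big_split /= sum_nat_const_nat subn1 muln1 leq_add2l.
by rewrite [X in (_ <= X)%N](@big_cat_nat _ _ _ t.+1 1 n.*2.+1) //= leq_addr.
Qed.

Lemma exp2_le_central_binomial (n : nat) : (2 ^ n <= 'C(n.*2, n))%N.
Proof.
elim: n => [|n IH]; first by rewrite bin0.
have h : ('C(n.*2, n) <= 'C(n.*2.+1, n.+1))%N by rewrite binS leq_addl.
have e : 'C(n.*2.+1, n) = 'C(n.*2.+1, n.+1).
  rewrite -(@bin_sub n.*2.+1 n) -addnn; last by rewrite leqW // leq_addr.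
  by rewrite -addSn addnK.
rewrite doubleS binS e expnS mul2n -addnn.
by apply: leq_add; apply: leq_trans IH h.
Qed.

Lemma prod_primesE (n : nat) : (0 < n)%N ->
  n = (\prod_(p <- primes n) p ^ logn p n)%N.
Proof.
by move=> n0; rewrite {1}(prod_prime_decomp n0) prime_decompE big_map.
Qed.

(** Every prime power exactly dividing ['C(n.*2, n)] is at most [n.*2], hence below
    [2 ^ (trunc_log 2 n.*2).+1]. Multiply over the primes, bound the coefficient below by [2 ^ n],
    and compare exponents of 2. *)
Lemma le_prime_count (n : nat) :
  (n <= (trunc_log 2 n.*2).+1 * count prime (iota 0 n.*2.+1))%N.
Proof.
case: (posnP n) => [->//|n0].
have C0 : (0 < 'C(n.*2, n))%N by rewrite bin_gt0 -addnn leq_addr.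
have pow p : p \in primes 'C(n.*2, n) -> (p ^ logn p 'C(n.*2, n) <= n.*2)%N.
  rewrite mem_primes => /and3P[pp _ _].
  apply: (@leq_trans (p ^ trunc_log p n.*2)).
    by rewrite leq_pexp2l ?prime_gt0 // logn_central_binomial_le.
  by apply: trunc_logP; rewrite ?prime_gt1 ?double_gt0.
have sz : (size (primes 'C(n.*2, n)) <= count prime (iota 0 n.*2.+1))%N.
  rewrite -size_filter; apply: uniq_leq_size (primes_uniq _) _ => p pC.
  have := pC; rewrite mem_primes => /and3P[pp _ _].
  rewrite mem_filter pp mem_iota /= add0n ltnS; apply: leq_trans (pow _ pC).
  by rewrite -{1}[p]expn1 leq_pexp2l ?logn_gt0 // prime_gt0.
rewrite -(@leq_exp2l 2) // expnM; apply: leq_trans (exp2_le_central_binomial n) _.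
apply: (@leq_trans ((2 ^ (trunc_log 2 n.*2).+1) ^ size (primes 'C(n.*2, n)))); last first.
  by rewrite leq_pexp2l ?expn_gt0.
rewrite {1}(prod_primesE C0) -[X in (_ ^ X)%N]count_predT -sum1_count expn_sum !big_seq.
apply: leq_prod => p /pow h; rewrite expn1; apply: leq_trans h _.
by rewrite ltnW // trunc_log_ltn.
Qed.

Lemma exp2_size_primes_le (m : nat) : (0 < m)%N -> (2 ^ size (primes m) <= m)%N.
Proof.
move=> m0; rewrite {2}(prod_primesE m0).
rewrite -[X in (2 ^ X)%N]count_predT -sum1_count expn_sum !big_seq.
apply: leq_prod => p pm; rewrite expn1.
have := pm; rewrite mem_primes => /and3P[pp _ _].
apply: leq_trans (prime_gt1 pp) _.
by rewrite -{1}[p]expn1 leq_pexp2l ?logn_gt0 // prime_gt0.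
Qed.

(** Let [D] be half the number of primes up to [x] not dividing [m]. Fewer than [D.+1] of them lie
    below [D]; discarding these leaves at least [D] primes, so one number bounds from below both the
    size of [X] and its elements. *)
Lemma exists_large_coprime_primes (x m : nat) : (0 < m)%N -> (x <= m)%N ->
  exists (D : nat) (X : {set 'I_x.+1}),
  [/\ (x./2 <= (trunc_log 2 m).+1 * (D.*2.+1 + trunc_log 2 m))%N,
      (D <= #|X|)%N &
      {in X, forall p : 'I_x.+1, [/\ prime p, coprime p m & D <= p]%N}].
Proof.
move=> m0 xm; set t := trunc_log 2 m.
pose Y := [set p : 'I_x.+1 | prime p & coprime p m].
pose D := #|Y|./2; exists D, [set p in Y | (D <= p)%N]; split; last first.
- by move=> p; rewrite !inE => /andP[/andP[-> ->] ->].
- have : (#|[set p in Y | (p < D)%N]| <= D)%N.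
    case: (posnP D) => [->|D0].
      by rewrite leqn0 cards_eq0; apply/eqP/setP => p; rewrite !inE andbF.
    have := @card_congruent_le _ [set p in Y | (p < D)%N] val 1 0 D.-1 isT.
    rewrite divn1 prednK //; apply.
    + by move=> ? ? _ _; apply: val_inj.
    + by move=> ? ? _ _; rewrite !modn1.
    + by move=> p; rewrite !inE /= => /andP[_ h]; lia.
  have -> : #|[set p in Y | (D <= p)%N]| = (#|Y| - #|[set p in Y | (p < D)%N]|)%N.
    rewrite -(cardsID [set p : 'I_x.+1 | (p < D)%N] Y).
    have -> : [set p in Y | (p < D)%N] = Y :&: [set p : 'I_x.+1 | (p < D)%N].
      by apply/setP => p; rewrite !inE.
    by rewrite addKn; apply: eq_card => p; rewrite !inE -leqNgt andbC.
  have := odd_double_half #|Y|; rewrite -/D -addnn; lia.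
have Yle : (#|Y| <= D.*2.+1)%N.
  by rewrite -[X in (X <= _)%N]odd_double_half -/D; case: odd; rewrite ?add1n ?add0n.
have szt : (size (primes m) <= t)%N.
  by apply: trunc_log_max => //; apply: exp2_size_primes_le.
have h2 : (x./2.*2 <= x)%N by rewrite -[X in (_ <= X)%N]odd_double_half leq_addl.
(* A prime up to [x./2.*2] is in [Y] or divides [m], and the latter number at most [t]. *)
apply: leq_trans (le_prime_count _) _; apply: leq_mul.
  by rewrite ltnS leq_trunc_log // (leq_trans h2).
apply: (@leq_trans (#|Y| + size (primes m))); last exact: leq_add.
rewrite -size_filter.
rewrite -[#|Y|](size_image (fun p : 'I_x.+1 => p : nat)) -size_cat.
apply: uniq_leq_size; first by rewrite filter_uniq ?iota_uniq.
move=> p; rewrite mem_filter mem_iota add0n mem_cat => /andP[pp] /= px.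
case: (boolP (p %| m)%N) => pm; first by rewrite mem_primes pp m0 pm orbT.
apply/orP; left; have px1 : (p < x.+1)%N by apply: leq_trans px _; rewrite ltnS.
by apply/mapP; exists (Ordinal px1) => //; rewrite mem_enum inE /= pp prime_coprime.
Qed.

(** * Collisions among products modulo [m.+1], and the second moment *)

Definition residue (m : nat) (z : int) : 'I_m.+1 := inord `|(z %% m.+1%:Z)%Z|.

Lemma val_residue (m : nat) (z : int) : ((residue m z : nat) : int) = (z %% m.+1%:Z)%Z.
Proof.
have h : 0 <= (z %% m.+1%:Z)%Z by exact: modz_ge0.
rewrite /residue inordK; first by rewrite gez0_abs.
by rewrite -ltz_nat gez0_abs // ltz_pmod.
Qed.

Lemma residue_eq (m : nat) (z z' : int) :
  (residue m z == residue m z') = (z == z' %[mod m.+1%:Z])%Z.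
Proof.
apply/eqP/eqP => [/(congr1 (fun i => ((i : 'I__) : nat) : int))|e].
  by rewrite !val_residue.
by rewrite /residue e.
Qed.

Section SecondMoment.
Variables (m N n : nat) (S : int).

Definition residue_mul (p : 'I_n.+1 * 'I_N) : 'I_m.+1 :=
  residue m ((p.1 : nat)%:Z * (S + 1 + (p.2 : nat)%:Z)).

Definition collisions (x1 x2 : 'I_n.+1) : {set 'I_N * 'I_N} :=
  [set p | residue_mul (x1, p.1) == residue_mul (x2, p.2)].

(** Here [x] is invertible modulo [m.+1], and the [y]'s are distinct modulo [m.+1] because
    [N <= m.+1]; only pairs with equal entries collide. *)
Lemma card_collisions_diag (x : 'I_n.+1) : (N <= m.+1)%N -> coprime x m.+1 ->
  (#|collisions x x| <= N)%N.
Proof.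
move=> Nm co; rewrite -[X in (_ <= X)%N]card_ord.
rewrite -(card_in_imset (f := fst) (D := collisions x x)); first exact: max_card.
move=> [i j] [i' j']; rewrite !inE /residue_mul /= !residue_eq => h h' ii.
rewrite -{i'}ii in h' *.
congr pair; apply: val_inj => /=.
have : (x%:Z * (S + 1 + j%:Z) == x%:Z * (S + 1 + j'%:Z) %[mod m.+1%:Z])%Z.
  by rewrite -(eqP h) -(eqP h').
rewrite eqz_mod_dvd -mulrBr Gauss_dvdzr; last by rewrite coprimez_sym.
rewrite [X in (_ %| X)%Z](_ : _ = j%:Z - j'%:Z); last by ring.
rewrite -eqz_mod_dvd !modz_small; last 2 first.
- by rewrite /= ltz_nat (leq_trans (ltn_ord j')).
- by rewrite /= ltz_nat (leq_trans (ltn_ord j)).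
by move=> /eqP [].
Qed.

Lemma card_collisions_le (x1 x2 : 'I_n.+1) : (0 < x2)%N -> coprime x1 x2 ->
  (m.+1 * x2 * #|collisions x1 x2| <=
   N * N * x2 + N * m.+1 + x2 * ((x1 + x2) * N + m.+1))%N.
Proof.
move=> x20 co.
(* The constant left when [x1 * (S + 1 + i) = x2 * (S + 1 + j)] is rewritten in terms of [i] and
   [N.-1 - j]. *)
pose e : nat := residue m (x2%:Z * (S + 1 + (N.-1)%:Z) - x1%:Z * (S + 1)).
apply: leq_trans (@card_lin_congruence_le N m.+1 e x1 x2 isT x20 co (ltn_ord _)).
rewrite leq_mul2l; apply/orP; right.
(* reversing the second coordinate turns the difference into a sum of naturals *)
pose g (p : 'I_N * 'I_N) := (p.1, rev_ord p.2).
rewrite -[X in (X <= _)%N](card_imset (f := g)); last first.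
  by move=> [i j] [i' j'] /(congr1 (fun p => (p.1, rev_ord p.2))); rewrite /= !rev_ordK.
apply: subset_leq_card; apply/subsetP => _ /imsetP[[i j] + ->].
rewrite !inE /residue_mul /= residue_eq => h.
have jN := ltn_ord j.
rewrite -eqz_nat -!modz_nat.
rewrite /e val_residue modz_mod eqz_mod_dvd.
move: h; rewrite eqz_mod_dvd.
congr (_ %| _)%Z; rewrite !PoszD !PoszM -subzn //.
have -> : N%:Z = N.-1%:Z + 1 by lia.
rewrite (_ : j.+1%:Z = j%:Z + 1); last by lia.
ring.
Qed.

(** In the collision bound the expected term [(P * V) ^+ 2 / M] is separated from the rest [E].
    Cauchy-Schwarz then bounds [(M - c) * (P * V) ^+ 2] by [c * M * E], where [c] counts the
    residues hit, and [c <= M] finishes. The four summands are those of [E], rescaled. *)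
Lemma missed_residues_le (R : realFieldType) (B : R) (X : {set 'I_n.+1}) :
  (0 < N <= m.+1)%N -> (0 < #|X|)%N -> 0 < B ->
  {in X, forall x : 'I_n.+1, coprime x m.+1 /\ B <= x%:R} ->
  {in X &, forall x y : 'I_n.+1, x != y -> coprime x y} ->
  m.+1%:R - #|residue_mul @: setX X [set: 'I_N]|%:R <=
  m.+1%:R * (m.+1%:R / (#|X|%:R * N%:R) + m.+1%:R / (B * N%:R) +
             2 * n%:R / N%:R + m.+1%:R / N%:R ^+ 2) :> R.
Proof.
move=> /andP[N0 Nm] P0 B0 XB Xco; set M : R := m.+1%:R.
set I := residue_mul @: _; set P : R := #|X|%:R; set V : R := N%:R.
have M0 : 0 < M by rewrite ltr0n.
have V0 : 0 < V by rewrite ltr0n.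
have PR0 : 0 < P by rewrite ltr0n.
have IM : #|I|%:R <= M by rewrite ler_nat -[leqRHS]card_ord max_card.
(* The off-diagonal bound divided by [M * x2], made uniform by [B <= x2] and [x1 + x2 <= 2 * n]. *)
pose T0 : R := V ^+ 2 / M + V / B + 2 * n%:R * V / M + 1.
have T00 : 0 <= T0.
  by rewrite /T0 !addr_ge0 // ?divr_ge0 ?mulr_ge0 ?exprn_ge0 // ltW.
have off x1 x2 : x1 \in X -> x2 \in X -> x1 != x2 -> #|collisions x1 x2|%:R <= T0.
  move=> Xx1 Xx2 neq; have co := Xco _ _ Xx1 Xx2 neq.
  have [_ Bx2] := XB _ Xx2.
  have x2R : 0 < x2%:R :> R by exact: lt_le_trans Bx2.
  have x20 : (0 < x2)%N by rewrite -(ltr0n R).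
  have := card_collisions_le x20 co.
  rewrite -(ler_nat R) !(natrM, natrD) -/M -/V => h.
  apply: (@le_trans _ _ (V ^+ 2 / M + V / x2%:R + (x1%:R + x2%:R) * V / M + 1)).
    rewrite -(ler_pM2l (mulr_gt0 M0 x2R)); apply: le_trans h _.
    rewrite le_eqVlt; apply/orP; left; apply/eqP.
    by clearbody M V; field; rewrite !gt_eqF.
  rewrite /T0 lerD2r; apply: lerD.
    by rewrite lerD2l ler_pM2l // lef_pV2.
  rewrite ler_pM2r ?invr_gt0 // ler_pM2r //.
  have := ltn_ord x1; have := ltn_ord x2; rewrite !ltnS -!(ler_nat R) => a b.
  lra.
have sumE : (#|[set q in setX (setX X [set: 'I_N]) (setX X [set: 'I_N]) |
                   residue_mul q.1 == residue_mul q.2]| <=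
    \sum_(x1 in X) \sum_(x2 in X) #|collisions x1 x2|)%N.
  under eq_bigr do under eq_bigr do rewrite -sum1_card.
  rewrite pair_big_dep /= pair_big_dep /= sum1_card.
  set L := [set q in _ | _].
  (* Regroups two pairs (x, y) as the pair of x's and the pair of y's. *)
  pose g (q : ('I_n.+1 * 'I_N) * ('I_n.+1 * 'I_N)) :=
    ((q.1.1, q.2.1), (q.1.2, q.2.2)).
  rewrite -(card_imset (f := g)); last first.
    by move=> [[a b] [c d]] [[a' b'] [c' d']] /= [-> -> -> ->].
  apply: subset_leq_card; apply/subsetP => _ /imsetP[[[a b] [c d]] + ->].
  by rewrite !inE /= !andbT => h; rewrite unfold_in /= inE.
have QR : (\sum_(x1 in X) \sum_(x2 in X) #|collisions x1 x2|)%:R <= P * (V + P * T0).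
  rewrite natr_sum; apply: (@le_trans _ _ (\sum_(x1 in X) (V + P * T0))).
    apply: ler_sum => x Xx; rewrite natr_sum (bigD1 x) //=; apply: lerD.
      by rewrite ler_nat card_collisions_diag //; have [] := XB _ Xx.
    apply: (@le_trans _ _ (\sum_(y in X | y != x) T0)).
      by apply: ler_sum => y /andP[Xy yx]; apply: off => //; rewrite eq_sym.
    apply: (@le_trans _ _ (\sum_(y in X) T0)).
      rewrite [X in _ <= X](bigD1 x) //=; lra.
    by rewrite sumr_const /P mulr_natl.
  by rewrite sumr_const -[X in X <= _]mulr_natl.
have := card_sqr_le_imset (setX X [set: 'I_N]) residue_mul.
rewrite -/I cardsX cardsT card_ord => CS.
have {CS} : (P * V) ^+ 2 <= #|I|%:R * (P * (V + P * T0)).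
  apply: (@le_trans _ _ (#|I| * \sum_(x1 in X) \sum_(x2 in X) #|collisions x1 x2|)%N%:R).
    rewrite -natrM -natrX ler_nat; apply: leq_trans CS _.
    by rewrite leq_mul2l sumE orbT.
  by rewrite natrM ler_wpM2l.
move: IM; move: (#|I|%:R : R) => c cM h.
have PV0 : 0 < (P * V) ^+ 2 by rewrite exprn_gt0 // mulr_gt0.
rewrite -(ler_pM2l PV0).
pose E : R := P * V + P ^+ 2 * (V / B + 2 * n%:R * V / M + 1).
have E0 : 0 <= E.
  by rewrite /E !addr_ge0 ?mulr_ge0 ?addr_ge0 ?exprn_ge0 // ?divr_ge0 ?mulr_ge0 // ?ltW.
have hE : M * (P * (V + P * T0)) = (P * V) ^+ 2 + M * E.
  by rewrite /E /T0; clearbody M V P; field; rewrite !gt_eqF.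
have -> : (P * V) ^+ 2 * (M * (M / (P * V) + M / (B * V) + 2 * n%:R / V +
                               M / V ^+ 2)) = M * (M * E).
  by rewrite /E; clearbody M V P; field; rewrite !gt_eqF.
have h2 : M * (P * V) ^+ 2 <= c * ((P * V) ^+ 2 + M * E).
  by rewrite -hE [X in _ <= X]mulrCA ler_pM2l.
have h3 : c * (M * E) <= M * (M * E) by rewrite ler_wpM2r // mulr_ge0 // ltW.
lra.
Qed.

End SecondMoment.

(** * Estimates for logarithms *)

(** With [u = ln m], the square root is [expR (u / 2)], at least its Taylor term of degree [k.+1].
    The spare factor [u] beats the constants once [u >= U]. *)
Lemma ln_pow_le_sqrt (R : realType) (c : R) (k : nat) : 0 < c ->
  exists m0 : nat, forall m : nat, (m0 <= m)%N ->
    1 <= ln (m%:R : R) /\ c * ln (m%:R : R) ^+ k <= m%:R `^ 2^-1.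
Proof.
move=> c0; pose U : R := 1 + c * (k.+1)`!%:R * 2 ^+ k.+1.
have U1 : 1 <= U by rewrite lerDl !mulr_ge0 ?exprn_ge0 // ltW.
exists (Num.trunc (expR U)).+1 => m hm.
have Um : U <= ln (m%:R : R).
  have h : expR U <= m%:R.
    apply: ltW; apply: (lt_le_trans (truncnS_gt _)).
    by rewrite ler_nat.
  rewrite -[U]expRK ler_ln ?posrE ?expR_gt0 //.
  exact: lt_le_trans (expR_gt0 _) h.
split; first exact: le_trans Um.
have m0 : m%:R != 0 :> R by rewrite pnatr_eq0; case: m hm {Um}.
rewrite /powR (negPf m0); set u := ln _ in Um *.
have u0 : 0 <= u by apply: le_trans Um; lra.
apply: le_trans (expR_ge1Dxn k _); last by rewrite mulr_ge0 // invr_ge0.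
apply: (@le_trans _ _ ((2^-1 * u) ^+ k.+1 / (k.+1)`!%:R)); last by rewrite lerDr.
rewrite ler_pdivlMr ?ltr0n ?fact_gt0 // exprMn [u ^+ k.+1]exprSr exprVn.
rewrite ler_pdivlMl ?exprn_gt0 //.
rewrite [X in X <= _](_ : _ = u ^+ k * (c * (k.+1)`!%:R * 2 ^+ k.+1)); last by ring.
rewrite ler_wpM2l ?exprn_ge0 //; apply: le_trans Um; rewrite /U; lra.
Qed.

Lemma trunc_log2_le_ln (R : realType) (m : nat) : (0 < m)%N ->
  (trunc_log 2 m)%:R <= 2 * ln (m%:R : R).
Proof.
(* [ln 2 >= 1/2] comes from [expR (- 1/2) >= 1 - 1/2]. *)
move=> m0; have ln2 : 2^-1 <= ln (2 : R).
  rewrite -[2^-1]expRK ler_ln ?posrE ?expR_gt0 //.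
  have h := expR_ge1Dx (- 2^-1 : R).
  have e0 := expR_gt0 (2^-1 : R).
  rewrite expRN in h.
  have : (1 - 2^-1) * expR (2^-1 : R) <= 1.
    by rewrite -ler_pdivlMr // div1r; apply: le_trans h; lra.
  lra.
have : ln ((2 : R) ^+ trunc_log 2 m) <= ln m%:R.
  rewrite ler_ln ?posrE ?exprn_gt0 ?ltr0n // -natrX ler_nat.
  exact: trunc_logP.
rewrite lnXn // -[ln 2 *+ _]mulr_natl => h.
have : (trunc_log 2 m)%:R * 2^-1 <= (trunc_log 2 m)%:R * ln (2 : R).
  by rewrite ler_wpM2l.
lra.
Qed.

(** * Choice of parameters and final estimate *)

Lemma residue_mul_sub_product_residues (R : realType) (eps : R) (m N n : nat)
    (S : int) (X : {set 'I_n.+1}) :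
  {in X, forall x : 'I_n.+1, 0 < x}%N ->
  n%:R <= m.+1%:R `^ 2^-1 :> R ->
  N%:R <= m.+1%:R `^ 2^-1 * ln m.+1%:R `^ (2 + eps) :> R ->
  @residue_mul m N n S @: setX X [set: 'I_N] \subset product_residues eps m.+1 S.
Proof.
move=> X0 hn hN; apply/subsetP => _ /imsetP[[x j] + ->]; rewrite !inE /= andbT => Xx.
apply/asboolP; exists (x : nat)%:Z, (S + 1 + (j : nat)%:Z); split.
- by rewrite lez_nat X0.
- by apply: le_trans hn; rewrite -pmulrn ler_nat -ltnS.
- by rewrite lerDl.
- rewrite -addrA intrD lerD2l; apply: le_trans hN.
  rewrite (_ : 1 + (j : nat)%:Z = j.+1%:Z); last by lia.
  by rewrite -pmulrn ler_nat.
- by rewrite val_residue modz_mod.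
Qed.

Lemma half_ge (R : realFieldType) (s : R) (x : nat) : s < x.+1%:R -> s / 2 - 1 <= x./2%:R.
Proof.
have : (x <= x./2 + x./2 + 1)%N.
  rewrite -[X in (X <= _)%N]odd_double_half -addnn; case: odd; lia.
rewrite -(ler_nat R) -natr1 !natrD => h; lra.
Qed.

Theorem corollary4 (R : realType) (eps : R) (heps : 0 < eps) :
  exists (C : R) (m0 : nat), forall (m : nat) (S : int), (m0 <= m)%N ->
    `| #|product_residues eps m S|%:R - m%:R |
      <= C * ln (m%:R : R) `^ (- eps) * m%:R.
Proof.
(* An integer exponent above [2 + eps], so that [L <= l ^+ k]. *)
pose k := (Num.trunc (2 + eps)).+1.
have [m0 hm0] := @ln_pow_le_sqrt R 96 k ltac:(lra).
exists 200, m0 => -[|m] S /hm0 [].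
  (* Modulus 0 is excluded by [1 <= ln m], since [ln 0 = 0] by convention. *)
  by rewrite ln0 // ler10.
set l := ln _; set s : R := _ `^ _; set M : R := m.+1%:R => l1 sk.
have l0 : 0 < l by lra.
set w := l `^ eps; set L := l `^ (2 + eps).
have w1 : 1 <= w by rewrite -(powRr0 l) ler_powR // ltW.
have LE : L = l ^+ 2 * w.
  rewrite /L powRD; last by rewrite (gt_eqF l0) implybT.
  by rewrite powR_mulrn // ltW.
have k2 : 2 + eps <= k%:R by rewrite ltW // truncnS_gt.
have Lk : L <= l ^+ k by rewrite -(powR_mulrn k (ltW l0)) ler_powR.
have ll : l ^+ 2 <= L by rewrite LE ler_peMr // exprn_ge0 // (ltW l0).
have l2 : l <= l ^+ 2 by rewrite expr2 ler_peMr // ltW.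
have sL : 96 * L <= s by apply: le_trans sk; rewrite ler_pM2l.
have s0 : 0 < s by lra.
have sM : s ^+ 2 = M by rewrite /s powR12_sqrt // sqr_sqrtr.
rewrite powRN -/w.
pose x := Num.trunc s; pose N := Num.trunc (s * L).
have /andP[xs sx] := truncn_itv (ltW s0); rewrite -/x in xs sx.
have L0 : 0 < L by lra.
have sL0 : 0 < s * L by rewrite mulr_gt0.
have /andP[NL LN] := truncn_itv (ltW sL0); rewrite -/N in NL LN.
have NM : (N <= m.+1)%N.
  rewrite -(ler_nat R) -/M -sM; apply: le_trans NL _.
  by rewrite expr2 ler_pM2l //; lra.
have xM : (x <= m.+1)%N.
  rewrite -(ler_nat R) -/M -sM; apply: le_trans xs _.
  by rewrite expr2 ler_peMr //; lra.
have [D [X [hD DX XP]]] := exists_large_coprime_primes (isT : (0 < m.+1)%N) xM.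
have tl : (trunc_log 2 m.+1)%:R <= 2 * l by exact: trunc_log2_le_ln.
(* [D] has order at least [s / l]: the prime count gives [s / 2 - 1 <= 6 * l * D + 9 * l ^+ 2], and
   [96 * l ^+ 2 <= s] absorbs the lower-order terms. *)
have DR : s <= 48 * l * D%:R.
  have h1 := half_ge sx.
  have h2 : x./2%:R <= (2 * l + 1) * (2 * D%:R + 1 + 2 * l).
    move: hD; rewrite -(ler_nat R) natrM => h; apply: le_trans h _.
    apply: ler_pM => //; first by rewrite -natr1; lra.
    by rewrite natrD -natr1 -mul2n natrM; lra.
  have h3 : (2 * l + 1) * (2 * D%:R + 1 + 2 * l) <= 3 * l * (2 * D%:R + 3 * l).
    apply: ler_pM; rewrite ?addr_ge0 ?mulr_ge0 //; lra.
  have h4 : 3 * l * (2 * D%:R + 3 * l) = 6 * (l * D%:R) + 9 * l ^+ 2 by ring.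
  rewrite -mulrA; lra.
have D0 : 0 < D%:R :> R.
  have : 0 < 48 * l * D%:R by apply: lt_le_trans DR.
  by rewrite pmulr_rgt0 // mulr_gt0.
have NV : s * L / 2 <= N%:R.
  have : 2 <= s * L by apply: (@le_trans _ _ (2 * 1)); [lra|apply: ler_pM; lra].
  by rewrite -natr1 in LN; lra.
have N0 : 0 < N%:R :> R by lra.
have sub : @residue_mul m N x S @: setX X [set: 'I_N] \subset product_residues eps m.+1 S.
  by apply: residue_mul_sub_product_residues => // p /XP[/prime_gt0].
have P0 : (0 < #|X|)%N by apply: leq_trans DX; rewrite -(ltr0n R).
have hX : {in X, forall p : 'I_x.+1, coprime p m.+1 /\ D%:R <= p%:R :> R}.
  by move=> p /XP[_ cop Dp]; rewrite ler_nat.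
have coX : {in X &, forall p q : 'I_x.+1, p != q -> coprime p q}.
  by move=> p q /XP[pp _ _] /XP[pq _ _] ne; rewrite prime_coprime // dvdn_prime2.
have hN : (0 < N <= m.+1)%N by rewrite NM -(ltr0n R) N0.
have miss := @missed_residues_le m N x S R D%:R X hN P0 D0 hX coX.
have card1 := subset_leq_card sub.
have card2 : (#|product_residues eps m.+1 S| <= m.+1)%N.
  by rewrite -[leqRHS]card_ord max_card.
rewrite -(ler_nat R) in card1; rewrite -(ler_nat R) -/M in card2.
(* At most [m.+1] classes are hit, so only the missed ones need a bound. *)
rewrite distrC ger0_norm ?subr_ge0 //.
apply: le_trans (_ : M - #|@residue_mul m N x S @: setX X [set: 'I_N]|%:R <= _).
  by rewrite lerD2l lerN2.
apply: le_trans miss _; rewrite -/M mulrC ler_pM2r; last by rewrite ltr0n.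
have PR0 : 0 < #|X|%:R :> R by rewrite ltr0n.
have PD : D%:R <= #|X|%:R :> R by rewrite ler_nat.
have b2 : M / (D%:R * N%:R) <= 96 * l / L.
  have h : s * (s * L / 2) <= 48 * l * D%:R * N%:R.
    by apply: ler_pM => //; [exact: ltW|rewrite divr_ge0 // ltW].
  rewrite ler_pdivrMr ?mulr_gt0 // mulrAC ler_pdivlMr // -sM; lra.
have b1 : M / (#|X|%:R * N%:R) <= 96 * l / L.
  apply: le_trans b2; rewrite ler_pM2l ?ltr0n // lef_pV2 ?posrE ?mulr_gt0 //.
  by rewrite ler_pM2r.
have b3 : 2 * x%:R / N%:R <= 4 / L.
  have h : x%:R * L <= s * L by rewrite ler_pM2r.
  rewrite ler_pdivrMr // mulrAC ler_pdivlMr //; lra.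
have b4 : M / N%:R ^+ 2 <= 4 / L.
  have h : (s * L / 2) * (s * L / 2) <= N%:R * N%:R.
    by apply: ler_pM => //; rewrite divr_ge0 // ltW.
  have h' : s ^+ 2 * L * 1 <= s ^+ 2 * L * L.
    by rewrite ler_pM2l ?mulr_gt0 ?exprn_gt0 //; lra.
  rewrite ler_pdivrMr ?exprn_gt0 // mulrAC ler_pdivlMr // -sM; lra.
have b5 : 200 * l ^+ 2 / L = 200 * w^-1.
  by rewrite LE; field; rewrite !gt_eqF //; lra.
rewrite -b5.
(* The four errors add up to [(192 * l + 8) / L], and [1 <= l <= l ^+ 2] gives the constant 200. *)
apply: le_trans (_ : (96 * l + 96 * l + 4 + 4) / L <= _); first by rewrite !mulrDl; lra.
by rewrite ler_pM2r ?invr_gt0 //; lra.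
Qed.
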